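(* Let $(\tilde X(t),\tilde B(t),\Lambda(t))$ be a seed of a quantum cluster algebra $A_q$ and let $\{-,-\}$ be a Poisson structure compatible with $A_q$. Then the second deformation matrix $W(t)$ satisfies $$\tilde B(t)^\top W(t)=c\,(D\ \ O),$$ where $c\in\mathbb Z[q^{\pm\frac12}]$ and $D$ is the skew-symmetrizer of $\tilde B(t)$.
   Context: Notation: $[1,m]=\{1,\dots,m\}$; $[a]_+=\max\{a,0\}$, applied componentwise to vectors. Fix $n\le m$. Quantum cluster algebras. $\tilde B=(b_{ij})$ is an $m\times n$ integer matrix whose top $n\times n$ part $B$ is skew-symmetrizable: there is a positive diagonal matrix $D$ (the skew-symmetrizer) with $DB$ skew-symmetric. $\Lambda=(\lambda_{ij})$ is a skew-symmetric $m\times m$ integer matrix such that $(\tilde B,\Lambda)$ is a compatible pair: $\tilde B^\top\Lambda=(D\ \ O)$, an $n\times m$ matrix. Let $q$ be a formal variable. The quantum torus is the $\mathbb Z[q^{\pm 1/2}]$-algebra with basis $X^e$ ($e\in\mathbb Z^m$) and product $X^eX^f=q^{\frac12 e^\top\Lambda f}X^{e+f}$; $\mathscr F_q$ is its skew-field of fractions; $X_i=X^{e_i}$ with $e_i$ the standard basis. A quantum seed is $(\tilde X,\tilde B,\Lambda)$ with extended cluster $\tilde X=(X_1,\dots,X_m)$; $X_1,\dots,X_n$ are cluster variables and $X_{n+1},\dots,X_m$ are frozen. For $k\in[1,n]$ the mutation $\mu_k$ replaces $X_k$ by $X_k'=X^{-e_k+[b_k]_+}+X^{-e_k+[-b_k]_+}$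 ($b_k$ the $k$-th column of $\tilde B$), replaces $\tilde B$ by $\tilde B'$ with $b'_{ij}=-b_{ij}$ if $i=k$ or $j=k$ and $b'_{ij}=b_{ij}+\mathrm{sgn}(b_{ik})[b_{ik}b_{kj}]_+$ otherwise, and replaces $\Lambda$ by the skew-symmetric $\Lambda'$ with $\lambda'_{kj}=-\lambda_{kj}+\sum_{l=1}^m[b_{lk}]_+\lambda_{lj}$ for $j\ne k$ and $\lambda'_{ij}=\lambda_{ij}$ for $i,j\neq k$. The result is again a quantum seed, whose normalized monomials $X'^e$ satisfy the same relation with $\Lambda'$. $A_q$ is the $\mathbb Z[q^{\pm1/2}][X_{n+1}^{\pm1},\dots,X_m^{\pm1}]$-subalgebra of $\mathscr F_q$ generated by all cluster variables of all seeds obtained by iterated mutation; seeds are indexed by vertices $t$ of the $n$-regular tree. Poisson structures. A Poisson structure on an associative algebra over $k=\mathbb Z[q^{\pm1/2}]$ is a $k$-bilinear Lie bracket with $\{a,bc\}=\{a,b\}c+b\{a,c\}$ (the algebra need not be commutative). An extended cluster $\tilde X$ is log-canonical with respect to $\{-,-\}$ if $\{X_i,X_j\}=\omega_{ij}X^{e_i+e_j}$ with $\omega_{ij}\in\mathbb Z[q^{\pm1/2}]$ for all $i,j\in[1,m]$; then $\Omega=(\omega_{ij})$ is its Poisson matrix. $\{-,-\}$ is compatible with $A_q$ if all extended clusters are log-canonical. Second deformation matrix. With $[a]_{q^{1/2}}=\frac{q^{a/2}-q^{-a/2}}{q^{1/2}-q^{-1/2}}$, the second deformation matrix $W(t)=(W_{ij})_{m\times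 m}$ attached to a seed with deformation matrix $\Lambda(t)=(\lambda_{ij})$ and Poisson matrix $\Omega(t)=(\omega_{ij})$ is $W_{ij}=\frac{\omega_{ij}\lambda_{ij}}{[\lambda_{ij}]_{q^{1/2}}}$ if $\lambda_{ij}\ne0$, and $W_{ij}=\omega_{ij}$ if $\lambda_{ij}=0$.
   Formalization: As stated, c need not lie in Z[q^{±1/2}] (type A_2, λ_12=2, {a,b}=[a,b]/(q−q^{-1}) gives c=1/(q^{1/2}+q^{-1/2})); what is proved has c in the fraction field, and in Z[q^{±1/2}] when W(t) has entries there or the entries of Λ(t) have gcd 1. *)

(* Defs.v *)
From HB Require Import structures.
From mathcomp Require Import all_boot all_order all_algebra.

Set Implicit Arguments.
Unset Strict Implicit.
Unset Printing Implicit Defensive.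
Import Order.TTheory GRing.Theory Num.Theory.
Local Open Scope ring_scope.

(* Q(q^{1/2}), with the formal variable 'X standing for q^{1/2}.  The
   fractions of the quantum torus form an algebra over this field, since
   nonzero elements of Z[q^{+-1/2}] are central and invertible there. *)
Notation Kq := {fraction {poly int}}.

Definition qhalf : Kq := tofrac ('X : {poly int}).

(* Membership in the subring Z[q^{+-1/2}] of Kq. *)
Definition laurent (x : Kq) : Prop :=
  exists (f : {poly int}) (N : nat), x = tofrac f / qhalf ^+ N.

Definition qint (a : int) : Kq :=
  (qhalf ^ a - qhalf ^ (- a)) / (qhalf - qhalf^-1).

Definition pos_part (m : nat) (v : 'cV[int]_m) : 'cV[int]_m :=
  map_mx (fun a => Num.max a 0) v.

Definition std (m : nat) (i : 'I_m) : 'cV[int]_m := delta_mx i 0.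

Definition skew_symmetric (R : zmodType) (m : nat) (A : 'M[R]_m) : Prop :=
  A^T = - A.

(* D is the diagonal matrix with diagonal d; \tilde B has n + p rows. *)
Definition skew_symmetrizer (n p : nat) (d : 'rV[int]_n)
    (B : 'M[int]_(n + p, n)) : Prop :=
  (forall i, 0 < d 0 i) /\ skew_symmetric (diag_mx d *m usubmx B).

Definition compatible_pair (n p : nat) (d : 'rV[int]_n)
    (B : 'M[int]_(n + p, n)) (L : 'M[int]_(n + p)) : Prop :=
  [/\ skew_symmetrizer d B, skew_symmetric L
    & B^T *m L = row_mx (diag_mx d) 0].

(* The number of mutable directions is n, the number of frozen ones is p; the
   mutable indices are the lshift p k, the frozen ones the rshift n j. *)
Record seed (F : unitAlgType Kq) (n p : nat) := Seed {
  cluster : 'I_(n + p) -> F;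
  exch : 'M[int]_(n + p, n);
  deform : 'M[int]_(n + p)
}.

(* The normalized monomial X^e, written through the ordered product of the
   X_i ^ e_i; the prefactor is the one forced by the relation
   X^e X^f = q^{(e^T L f) / 2} X^{e+f}. *)
Definition nmon (F : unitAlgType Kq) (n p : nat) (s : seed F n p)
    (e : 'cV[int]_(n + p)) : F :=
  qhalf ^ (- \sum_(i < n + p) \sum_(j < n + p | (i < j)%N)
               e i 0 * e j 0 * deform s i j)
  *: \prod_(i < n + p) cluster s i ^ e i 0.

Definition exch_mut (n p : nat) (k : 'I_n) (B : 'M[int]_(n + p, n)) :
    'M[int]_(n + p, n) :=
  \matrix_(i, j)
    if (i == lshift p k) || (j == k) then - B i j
    else B i j + Num.sg (B i k) * Num.max (B i k * B (lshift p k) j) 0.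

Definition deform_mut_row (n p : nat) (k : 'I_n) (B : 'M[int]_(n + p, n))
    (L : 'M[int]_(n + p)) (j : 'I_(n + p)) : int :=
  - L (lshift p k) j + \sum_(l < n + p) Num.max (B l k) 0 * L l j.

Definition deform_mut (n p : nat) (k : 'I_n) (B : 'M[int]_(n + p, n))
    (L : 'M[int]_(n + p)) : 'M[int]_(n + p) :=
  \matrix_(i, j)
    if i == j then 0
    else if i == lshift p k then deform_mut_row k B L j
    else if j == lshift p k then - deform_mut_row k B L i
    else L i j.

Definition mutate (F : unitAlgType Kq) (n p : nat) (s : seed F n p)
    (k : 'I_n) : seed F n p :=
  let ek := std (lshift p k) in
  let bk := col k (exch s) in
  Seed
    (fun i => if i == lshift p k
              then nmon s (- ek + pos_part bk) + nmon s (- ek + pos_part (- bk))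
              else cluster s i)
    (exch_mut k (exch s))
    (deform_mut k (exch s) (deform s)).

(* A vertex t of the n-regular tree is given by the word of edge labels of a
   path from the root to t. *)
Definition seed_at (F : unitAlgType Kq) (n p : nat) (s0 : seed F n p)
    (t : seq 'I_n) : seed F n p :=
  foldl (@mutate F n p) s0 t.

Definition in_torus (F : unitAlgType Kq) (n p : nat) (s : seed F n p)
    (x : F) : Prop :=
  exists (E : seq 'cV[int]_(n + p)) (c : 'cV[int]_(n + p) -> Kq),
    (forall e, laurent (c e)) /\ x = \sum_(e <- E) c e *: nmon s e.

(* F is the skew-field of fractions of the quantum torus with basis the X^e:
   this determines F up to isomorphism. *)
Definition torus_fractions (F : unitAlgType Kq) (n p : nat) (s : seed F n p) :
    Prop :=
  [/\ forall e f : 'cV[int]_(n + p),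
        nmon s e * nmon s f
        = qhalf ^ ((e^T *m deform s *m f) 0 0) *: nmon s (e + f),
      forall (E : seq 'cV[int]_(n + p)) (c : 'cV[int]_(n + p) -> Kq),
        uniq E -> (forall e, laurent (c e)) ->
        \sum_(e <- E) c e *: nmon s e = 0 -> forall e, e \in E -> c e = 0,
      forall x : F, x != 0 -> x \is a GRing.unit
    & forall x : F, exists a b : F,
        [/\ in_torus s a, in_torus s b, b != 0 & x = a * b^-1]].

Definition initial_quantum_seed (F : unitAlgType Kq) (n p : nat)
    (d : 'rV[int]_n) (s : seed F n p) : Prop :=
  compatible_pair d (exch s) (deform s) /\ torus_fractions s.

Inductive in_Aq (F : unitAlgType Kq) (n p : nat) (s0 : seed F n p) :
    F -> Prop :=
| Aq_scalar c : laurent c -> in_Aq s0 (c *: 1)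
| Aq_frozen (j : 'I_p) : in_Aq s0 (cluster s0 (rshift n j))
| Aq_frozenV (j : 'I_p) : in_Aq s0 (cluster s0 (rshift n j))^-1
| Aq_cluster (t : seq 'I_n) (i : 'I_n) :
    in_Aq s0 (cluster (seed_at s0 t) (lshift p i))
| Aq_add x y : in_Aq s0 x -> in_Aq s0 y -> in_Aq s0 (x + y)
| Aq_mul x y : in_Aq s0 x -> in_Aq s0 y -> in_Aq s0 (x * y).

(* A Poisson structure on the Z[q^{+-1/2}]-subalgebra A of F; the values of br
   outside A are irrelevant. *)
Record poisson_structure (F : unitAlgType Kq) (A : F -> Prop)
    (br : F -> F -> F) : Prop := PoissonStructure {
  br_closed : forall a b, A a -> A b -> A (br a b);
  br_linear_l : forall x a b c, laurent x -> A a -> A b -> A c ->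
    br (x *: a + b) c = x *: br a c + br b c;
  br_linear_r : forall x a b c, laurent x -> A a -> A b -> A c ->
    br a (x *: b + c) = x *: br a b + br a c;
  br_alternating : forall a, A a -> br a a = 0;
  br_jacobi : forall a b c, A a -> A b -> A c ->
    br a (br b c) + br b (br c a) + br c (br a b) = 0;
  br_leibniz : forall a b c, A a -> A b -> A c ->
    br a (b * c) = br a b * c + b * br a c
}.

Definition poisson_matrix (F : unitAlgType Kq) (n p : nat) (br : F -> F -> F)
    (s : seed F n p) (Om : 'M[Kq]_(n + p)) : Prop :=
  forall i j : 'I_(n + p),
    laurent (Om i j) /\
    br (cluster s i) (cluster s j) = Om i j *: nmon s (std i + std j).

Definition log_canonical (F : unitAlgType Kq) (n p : nat) (br : F -> F -> F)
    (s : seed F n p) : Prop :=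
  exists Om : 'M[Kq]_(n + p), poisson_matrix br s Om.

Definition compatible_poisson (F : unitAlgType Kq) (n p : nat)
    (s0 : seed F n p) (br : F -> F -> F) : Prop :=
  poisson_structure (in_Aq s0) br /\
  forall t : seq 'I_n, log_canonical br (seed_at s0 t).

Definition second_deformation (m : nat) (L : 'M[int]_m) (Om : 'M[Kq]_m) :
    'M[Kq]_m :=
  \matrix_(i, j)
    if L i j == 0 then Om i j else Om i j * (L i j)%:~R / qint (L i j).

(* The quotients in second_deformation are taken in Kq and need not lie in
   Z[q^{+-1/2}].  Example (type A_2, L_12 = 2, D = 2I): {a, b} =
   [a, b] / (q - q^{-1}) is a compatible Poisson structure with Om_12 = 1, and
   W_12 = 2 / (q^{1/2} + q^{-1/2}). *)
Definition laurent_mx (m : nat) (W : 'M[Kq]_m) : Prop :=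
  forall i j, laurent (W i j).

(* The entries of L have greatest common divisor 1; if B^T L = (D O), this
   holds as soon as the diagonal entries of D have greatest common divisor 1. *)
Definition primitive_mx (m : nat) (L : 'M[int]_m) : Prop :=
  \big[gcdn/0%N]_(i < m) \big[gcdn/0%N]_(j < m) `|L i j|%N = 1%N.

(* Main.v *)
Require Import Defs.
From HB Require Import structures.
From mathcomp Require Import all_boot all_order all_algebra.
From mathcomp Require Import ring.
Set Implicit Arguments.
Unset Strict Implicit.
Unset Printing Implicit Defensive.
Import Order.TTheory GRing.Theory Num.Theory.
Local Open Scope ring_scope.

(* In a noncommutative Poisson algebra, expanding {ab, cd} by the Leibniz rule
   in both orders gives [a, c] {b, d} = {a, c} [b, d].  On a seed with
   log-canonical bracket, [X_i, X_j] is a fixed scalar times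
   [lambda_ij] X^{e_i + e_j}, so omega_ij = c [lambda_ij] for a single scalar c,
   whence W = c Lambda and B^T W = c B^T Lambda = c (D O).  The scalar c is a
   Laurent polynomial when Lambda is primitive because the a with c [a]
   Laurent form a subgroup of Z; and when W is, because c lambda and c [lambda]
   are then Laurent while [lambda] is monic up to a unit.

   Compatibility of (B, Lambda), the quasi-commutation of the X_i and their
   invertibility are transported along mutations; X_k' is nonzero because its
   two monomials quasi-commute with X_k with different exponents. *)

(** * Laurent polynomials and quantum integers *)

Lemma qhalf_neq0 : qhalf != 0.
Proof. by rewrite tofrac_eq0 polyX_eq0. Qed.

Lemma qhalfD a b : qhalf ^ (a + b) = qhalf ^ a * qhalf ^ b.
Proof. exact: expfzDr qhalf_neq0. Qed.

Lemma qhalf_expz_eq1 (a : int) : qhalf ^ a = 1 -> a = 0.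
Proof.
have H (k : nat) : qhalf ^+ k = 1 -> k = 0%N.
  rewrite -tofracXn -tofrac1 => /eqP; rewrite tofrac_eq => /eqP.
  move/(congr1 (fun p : {poly int} => size p)).
  by rewrite size_polyXn size_poly1 => -[].
case: a => k; first by move=> /H ->.
by rewrite NegzE -invr_expz => /eqP; rewrite invr_eq1 => /eqP /H.
Qed.

Lemma qhalf_expz_inj : injective (fun a : int => qhalf ^ a).
Proof.
move=> a b /= eq_ab; apply/eqP; rewrite -subr_eq0; apply/eqP.
apply: qhalf_expz_eq1; rewrite qhalfD eq_ab -qhalfD subrr.
exact: expr0z.
Qed.

Lemma laurent0 : laurent 0.
Proof. by exists 0, 0%N; rewrite tofrac0 mul0r. Qed.

Lemma laurent_tofrac f : laurent (tofrac f).
Proof. by exists f, 0%N; rewrite expr0 divr1. Qed.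

Lemma laurent1 : laurent 1.
Proof. by rewrite -tofrac1; exact: laurent_tofrac. Qed.

Lemma laurentM x y : laurent x -> laurent y -> laurent (x * y).
Proof.
move=> [f [N ->]] [g [M ->]]; exists (f * g), (N + M)%N.
by rewrite tofracM exprD invfM mulrACA.
Qed.

Lemma laurentD x y : laurent x -> laurent y -> laurent (x + y).
Proof.
move=> [f [N ->]] [g [M ->]].
exists (f * 'X^M + g * 'X^N), (N + M)%N.
have hN k : qhalf ^+ k != 0 by rewrite expf_neq0 ?qhalf_neq0.
by rewrite addf_div ?hN // tofracD !tofracM !tofracXn exprD.
Qed.

Lemma laurentN x : laurent x -> laurent (- x).
Proof. by move=> [f [N ->]]; exists (- f), N; rewrite tofracN mulNr. Qed.

Lemma laurent_qhalf (a : int) : laurent (qhalf ^ a).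
Proof.
case: a => k; first by rewrite -exprnP -tofracXn; exact: laurent_tofrac.
by exists 1, k.+1; rewrite tofrac1 mul1r NegzE.
Qed.

Lemma qhalf_subV_neq0 : qhalf - qhalf^-1 != 0.
Proof.
apply: contraTneq isT => /eqP.
rewrite subr_eq0 -{1}[qhalf]expr1z -(exprN1 qhalf) => /eqP.
by move/qhalf_expz_inj.
Qed.

Lemma qint_eq0 (a : int) : (qint a == 0) = (a == 0).
Proof.
rewrite mulf_eq0 invr_eq0 (negPf qhalf_subV_neq0) orbF subr_eq0.
apply/eqP/eqP => [/qhalf_expz_inj /eqP|-> //].
by rewrite -subr_eq0 opprK -mulr2n mulrn_eq0 => /eqP.
Qed.

Lemma qint1 : qint 1 = 1.
Proof. by rewrite /qint exprN1 expr1z divff ?qhalf_subV_neq0. Qed.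

Lemma qintN a : qint (- a) = - qint a.
Proof. by rewrite /qint opprK -mulNr opprB. Qed.

(** Both coefficients are units of the Laurent ring, so the integers [a] with [c * qint a] Laurent
    are closed under addition. *)
Lemma qintD a b : qint (a + b) = qhalf ^ b * qint a + qhalf ^ (- a) * qint b.
Proof.
rewrite /qint opprD !qhalfD !mulrA -mulrDl; congr (_ / _).
ring.
Qed.

Lemma laurent_qint_mulz c a b :
  laurent (c * qint a) -> laurent (c * qint (b * a)).
Proof.
have cD x y : laurent (c * qint x) -> laurent (c * qint y) ->
    laurent (c * qint (x + y)).
  move=> cx cy; rewrite qintD mulrDr !(mulrCA c (qhalf ^ _)).
  by apply: laurentD; apply: laurentM => //; exact: laurent_qhalf.
have cN x : laurent (c * qint x) -> laurent (c * qint (- x)).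
  by move=> cx; rewrite qintN mulrN; exact: laurentN.
have c0 : laurent (c * qint 0).
  by rewrite (eqP (_ : qint 0 == 0)) ?qint_eq0 // mulr0; exact: laurent0.
move=> ca; elim/int_rect: b => [|k IH|k IH]; first by rewrite mul0r.
  by rewrite intS mulrDl mul1r; exact: cD.
by rewrite intS opprD mulrDl mulN1r; apply: cD => //; exact: cN.
Qed.

Lemma laurent_qint_gcd c (a b : nat) :
  laurent (c * qint a) -> laurent (c * qint b) ->
  laurent (c * qint (gcdn a b)).
Proof.
move=> ca cb; have [u [v uv]] := Bezoutz a b.
have -> : gcdn a b = u * a + v * b :> int by rewrite uv.
rewrite qintD mulrDr !(mulrCA c (qhalf ^ _)).
by apply: laurentD; apply: laurentM;
  (exact: laurent_qhalf || exact: laurent_qint_mulz).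
Qed.

Lemma laurent_qint_abs c (a : int) :
  laurent (c * qint a) -> laurent (c * qint `|a|%N).
Proof.
by move=> ca; rewrite abszE normrEsg; exact: laurent_qint_mulz.
Qed.

Lemma laurent_primitive m c (L : 'M[int]_m) :
  primitive_mx L -> (forall i j, laurent (c * qint (L i j))) -> laurent c.
Proof.
move=> L1 cL; pose P (a : nat) := laurent (c * qint a).
have P0 : P 0%N.
  by rewrite /P (eqP (_ : qint 0%N == 0)) ?qint_eq0 // mulr0; exact: laurent0.
(* Since [1] = 1, the claim is [P 1]; primitivity writes 1 as the iterated gcd of the entries, and
   [P] is stable under gcd by Bezout. *)
rewrite -[c]mulr1 -qint1 -[X in qint X]/(1%N : int) -L1.
apply: (big_ind P) => //; first exact: laurent_qint_gcd.
move=> i _; apply: (big_ind P) => //; first exact: laurent_qint_gcd.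
by move=> j _; exact: laurent_qint_abs.
Qed.

(** Gauss's lemma: contents are multiplicative and a monic polynomial has content 1, so [a] divides
    the content of the numerator of [c * a]. *)
Lemma laurent_div_monic c (a : int) (Q : {poly int}) :
  a != 0 -> Q \is monic -> laurent (c * a%:~R) -> laurent (c * tofrac Q) ->
  laurent c.
Proof.
move=> a0 Qm [f [N cf]] [g [M cg]].
have hN k : qhalf ^+ k != 0 by rewrite expf_neq0 ?qhalf_neq0.
have tofracZ (z : int) (p : {poly int}) :
    tofrac (z *: p) = z%:~R * tofrac p :> Kq.
  by rewrite -[z in LHS]intz scaler_int rmorphMz mulrzl.
have aK : a%:~R != 0 :> Kq.
  by rewrite -[a%:~R]mulr1 -tofrac1 -tofracZ tofrac_eq0 alg_polyC polyC_eq0.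
(* Both sides equal c a Q q^{(N+M)/2}. *)
have /eqP : tofrac (f * (Q * 'X^M)) = tofrac (a *: (g * 'X^N)).
  rewrite tofracZ !tofracM !tofracXn -/qhalf.
  have -> : tofrac f = c * a%:~R * qhalf ^+ N by rewrite cf divfK ?hN.
  have -> : tofrac g = c * tofrac Q * qhalf ^+ M by rewrite cg divfK ?hN.
  ring.
rewrite tofrac_eq => /eqP /(congr1 zcontents).
rewrite zcontentsZ !zcontentsM !(zcontents_monic (monicXn _ _)).
rewrite (zcontents_monic Qm) !mulr1 => fa.
exists (zcontents g *: zprimitive f), N; apply: (mulIf aK).
by rewrite cf [f in LHS]zpolyEprim fa !tofracZ rmorphM; ring.
Qed.

Lemma laurent_of_mulz c (a : int) :
  a != 0 -> laurent (c * a%:~R) -> laurent (c * qint a) -> laurent c.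
Proof.
(* With n = |a|, the monic polynomial X^{2n} - 1 is [n] up to the unit q^{n/2} and the Laurent
   factor q^{1/2} - q^{-1/2}. *)
move=> a0 ca cqa; apply: (@laurent_div_monic c `|a|%N ('X^(2 * `|a|) - 1%:P)).
- by rewrite eqz_nat absz_eq0.
- by rewrite monicXnsubC // muln_gt0 absz_gt0.
- rewrite abszE normrEsg rmorphM mulrCA; apply: laurentM => //.
  case: sgzP => _; rewrite ?rmorphN.
  + exact: laurent0.
  + exact: laurent1.
  + by apply: laurentN; exact: laurent1.
have := laurent_qint_abs cqa; set n := `|a|%N => cn.
have -> : tofrac ('X^(2 * n) - 1%:P) =
    qhalf ^ n * (qhalf - qhalf^-1) * qint n.
  rewrite /qint tofracB tofracXn tofrac1 -/qhalf mulrAC -mulrA.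
  rewrite divfK ?qhalf_subV_neq0 //.
  rewrite mulrBr -!qhalfD subrr mul2n -addnn; congr (_ - _).
rewrite mulrCA; apply: laurentM => //.
apply: laurentM; first exact: laurent_qhalf.
apply: laurentD; first exact: laurent_tofrac.
by apply: laurentN; rewrite -(exprN1 qhalf); exact: laurent_qhalf.
Qed.

(** * Mutation of compatible pairs *)

(** Turns the mutation rule into a difference of two products of positive parts, which can be
    treated factor by factor. *)
Lemma sg_max_mul (a b : int) :
  Num.sg a * Num.max (a * b) 0 =
  Num.max a 0 * Num.max b 0 - Num.max (- a) 0 * Num.max (- b) 0.
Proof.
have maxN x : 0 <= x -> Num.max (- x) 0 = 0 :> int.
  by move=> x0; apply/max_idPr; rewrite oppr_le0.
have maxP x : 0 <= x -> Num.max x 0 = x :> int by move/max_idPl.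
case: (sgrP a) => [->|a0|a0].
- by rewrite mul0r oppr0 maxxx !mul0r subrr.
- rewrite (maxN a) ?(maxP a) ?ltW // mul0r subr0 mul1r.
  by rewrite maxr_pMr ?mulr0 // ltW.
rewrite (maxP (- a)) ?oppr_ge0 ?ltW // -{2}[a]opprK maxN ?oppr_ge0 ?ltW //.
rewrite mul0r sub0r mulN1r; congr (- _).
by rewrite -mulrNN maxr_pMr ?mulr0 // oppr_ge0 ltW.
Qed.

Lemma trmx_std_mul m q (M : 'M[int]_(m, q)) i : (std i)^T *m M = row i M.
Proof. by rewrite /std trmx_delta -rowE. Qed.

Lemma skew_symmetrizerE (n p : nat) (d : 'rV[int]_n) (B : 'M[int]_(n + p, n)) :
  (forall i, 0 < d 0 i) ->
  (forall i j, d 0 i * B (lshift p i) j = - (d 0 j * B (lshift p j) i)) ->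
  skew_symmetrizer d B.
Proof.
move=> d_gt0 dB; split=> //; apply/matrixP=> i j.
by rewrite [LHS]mxE [RHS]mxE !mul_diag_mx !mxE dB.
Qed.

Lemma compatible_row (n p : nat) (d : 'rV[int]_n) (B : 'M[int]_(n + p, n))
    (L : 'M[int]_(n + p)) i :
  B^T *m L = row_mx (diag_mx d) 0 ->
  (col i B)^T *m L = d 0 i *: (std (lshift p i))^T.
Proof.
move=> BL; rewrite tr_col -row_mul BL; apply/rowP=> j; rewrite !mxE.
case: split_ordP => j' ->; rewrite !mxE ?eq_lshift ?eq_rlshift /=.
  by rewrite andbT mulr_natr eq_sym; case: eqP => // ->.
by rewrite mulr0.
Qed.

Lemma row_compatible (n p : nat) (d : 'rV[int]_n) (B : 'M[int]_(n + p, n))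
    (L : 'M[int]_(n + p)) :
  (forall i, (col i B)^T *m L = d 0 i *: (std (lshift p i))^T) ->
  B^T *m L = row_mx (diag_mx d) 0.
Proof.
move=> BL; apply/row_matrixP=> i; rewrite row_mul -tr_col BL.
apply/rowP=> j; rewrite !mxE.
case: split_ordP => j' ->; rewrite !mxE ?eq_lshift ?eq_rlshift /=.
  by rewrite andbT mulr_natr eq_sym; case: eqP => // ->.
by rewrite mulr0.
Qed.

Section Compatible.

Variables (n p : nat) (d : 'rV[int]_n).
Variables (B : 'M[int]_(n + p, n)) (L : 'M[int]_(n + p)).
Implicit Types (i j k : 'I_n) (x y u : 'cV[int]_(n + p)).

Hypothesis dB : skew_symmetrizer d B.

Lemma skew_symmetrizer_entry i j :
  d 0 i * B (lshift p i) j = - (d 0 j * B (lshift p j) i).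
Proof.
case: dB => _ /matrixP /(_ j i).
by rewrite [LHS]mxE [RHS]mxE !mul_diag_mx !mxE.
Qed.

Lemma exch_diag0 k : B (lshift p k) k = 0.
Proof.
have /eqP := skew_symmetrizer_entry k k; have [d_gt0 _] := dB.
rewrite -subr_eq0 opprK -mulr2n mulrn_eq0 mulf_eq0 /=.
by rewrite (gt_eqF (d_gt0 k)) => /eqP.
Qed.

Lemma max_symmetrizer i j :
  d 0 i * Num.max (B (lshift p i) j) 0 =
  d 0 j * Num.max (- B (lshift p j) i) 0.
Proof.
have [d_gt0 _] := dB.
rewrite !maxr_pMr ?(ltW (d_gt0 _)) // !mulr0 skew_symmetrizer_entry.
by rewrite mulrN.
Qed.

Lemma exch_mut_skew_symmetrizer k : skew_symmetrizer d (exch_mut k B).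
Proof.
have [d_gt0 _] := dB; apply: skew_symmetrizerE => // i j.
rewrite !mxE !eq_lshift orbC; case: ifP => _.
  by rewrite !mulrN skew_symmetrizer_entry.
rewrite !mulrDr skew_symmetrizer_entry opprD; congr (_ + _).
(* After scaling by d_i and d_j, the two products of positive parts trade places between the entries
   (i, j) and (j, i), which gives the sign. *)
have maxE i' : d 0 i' * Num.max (- B (lshift p i') k) 0 =
    d 0 k * Num.max (B (lshift p k) i') 0 by rewrite max_symmetrizer.
rewrite !sg_max_mul !mulrBr !mulrA !max_symmetrizer !maxE.
ring.
Qed.

Hypothesis skewL : skew_symmetric L.
Hypothesis BL : B^T *m L = row_mx (diag_mx d) 0.

Lemma deform_skew_entry a b : L a b = - L b a.
Proof. by have /matrixP /(_ b a) := skewL; rewrite !mxE. Qed.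

Lemma deform_skew_form x : x^T *m L *m x = 0.
Proof.
have /matrixP /(_ 0 0) : (x^T *m L *m x)^T = - (x^T *m L *m x).
  by rewrite !trmx_mul trmxK skewL mulmxA mulmxN mulNmx.
rewrite [LHS]mxE [RHS]mxE => /eqP.
rewrite -subr_eq0 opprK -mulr2n mulrn_eq0 /= => /eqP x0.
by rewrite [LHS]mx11_scalar x0 raddf0.
Qed.

Section Mutation.

Variable k : 'I_n.
Let K := lshift p k.

(* The exponents of the two monomials of the mutated variable X_k'. *)
Definition mut_vec (eps : bool) : 'cV[int]_(n + p) :=
  - std K + pos_part ((-1) ^+ eps *: col k B).

Lemma mut_vec_K eps : mut_vec eps K 0 = -1.
Proof. by rewrite !mxE !eqxx exch_diag0 mulr0 maxxx addr0. Qed.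

Lemma mut_vec_subK eps : (mut_vec eps - std K) K 0 = - 2.
Proof. by rewrite mxE mut_vec_K !mxE !eqxx. Qed.

Lemma mut_vec_sub : mut_vec false = mut_vec true + col k B.
Proof.
rewrite /mut_vec -addrA; congr (_ + _); apply/colP => l.
rewrite !mxE mul1r mulN1r; case: (lerP 0 (B l k)) => b0.
  by rewrite (max_idPr _) ?oppr_le0 // add0r.
by rewrite (max_idPl _) ?oppr_ge0 ?ltW // addNr.
Qed.

Lemma mut_vec_sub_deform :
  (mut_vec false)^T *m L = (mut_vec true)^T *m L + d 0 k *: (std K)^T.
Proof.
by rewrite mut_vec_sub linearD /= mulmxDl (compatible_row k BL).
Qed.

(** The two exponents differ by b_k, and b_k^T L is supported at [K]; away from [K] both signs
    therefore give the same row. *)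
Lemma mut_vec_deform eps (a : 'I_(n + p)) :
  a != K -> ((mut_vec eps)^T *m L) 0 a = deform_mut_row k B L a.
Proof.
move=> aK; transitivity (((mut_vec false)^T *m L) 0 a).
  case: eps => //; rewrite mut_vec_sub_deform [RHS]mxE.
  by rewrite [X in _ + X]mxE !mxE (negPf aK) mulr0 addr0.
rewrite /mut_vec linearD linearN /= mulmxDl mulNmx trmx_std_mul !mxE.
by congr (_ + _); apply: eq_bigr => l _; rewrite !mxE mul1r.
Qed.

(* The matrix E_eps of Berenstein and Zelevinsky: L' = E^T L E for both signs,
   while a column b_i of B (i <> k) mutates to E b_i for the sign of b_ki. *)
Definition mut_mx eps : 'M[int]_(n + p) :=
  1%:M + (mut_vec eps - std K) *m (std K)^T.

Lemma mut_mx_mul eps x : mut_mx eps *m x = x + x K 0 *: (mut_vec eps - std K).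
Proof.
rewrite mulmxDl mul1mx -mulmxA; congr (_ + _).
rewrite trmx_std_mul [row K x]mx11_scalar mul_mx_scalar.
by rewrite !mxE.
Qed.

Lemma mut_mx_col eps a :
  col a (mut_mx eps) = if a == K then mut_vec eps else std a.
Proof.
rewrite colE -/(std a) mut_mx_mul mxE eqxx andbT eq_sym.
by case: eqP => [->|_]; rewrite ?scale1r ?scale0r ?addr0 // addrC subrK.
Qed.

Lemma mut_mx_row eps a :
  row a (mut_mx eps) =
  (std a)^T + (mut_vec eps - std K) a 0 *: (std K)^T.
Proof.
rewrite linearD /= row1 row_mul [row a (_ - _)]mx11_scalar mul_scalar_mx.
by rewrite [row a _ 0 0]mxE /std !trmx_delta.
Qed.

(** A matrix I + v e_K^T squares to I + (2 + v_K) v e_K^T, and here v_K = -2. *)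
Lemma mut_mx_invol eps : mut_mx eps *m mut_mx eps = 1%:M.
Proof.
rewrite {1}/mut_mx mulmxDl mul1mx /mut_mx mulmxDr mulmx1 -mulmxA.
rewrite [(std K)^T *m _]mulmxA trmx_std_mul [row K _]mx11_scalar.
rewrite mul_scalar_mx [row K _ 0 0]mxE mut_vec_subK -scalemxAr.
by rewrite scaleNr scaler_nat mulr2n opprD addNKr addrK.
Qed.

(** Entry (a, b) on the right is the form L evaluated on columns a and b of E. Only column [K]
    differs from the standard basis, so only row and column [K] of L change. *)
Lemma deform_mutE eps :
  deform_mut k B L = (mut_mx eps)^T *m L *m mut_mx eps.
Proof.
apply/matrixP => a b.
have -> : ((mut_mx eps)^T *m L *m mut_mx eps) a b =
    ((col a (mut_mx eps))^T *m L *m col b (mut_mx eps)) 0 0.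
  by rewrite tr_col colE -row_mul mulmxA -row_mul -colE !mxE.
rewrite !mut_mx_col mxE.
rewrite -/K; have [->|ab] := eqVneq a b; first by rewrite deform_skew_form mxE.
have [aK|aK] := eqVneq a K.
  have bK : b != K by rewrite -aK eq_sym.
  by rewrite (negPf bK) -colE [RHS]mxE mut_vec_deform.
have [bK|bK] := eqVneq b K; last first.
  by rewrite -mulmxA trmx_std_mul -colE !mxE.
rewrite -mulmxA trmx_std_mul mxE -(mut_vec_deform eps aK) !mxE -sumrN.
by apply: eq_bigr => l _; rewrite (deform_skew_entry a) mulNr mulrC !mxE.
Qed.

(** The sign of b_ki decides which of the two products in [sg_max_mul] survives, and the matching E
    is chosen. *)
Lemma exch_mut_col i :
  i != k ->
  col i (exch_mut k B) = mut_mx (B K i < 0) *m col i B.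
Proof.
move=> ik; rewrite mut_mx_mul; apply/colP => a.
have [->|aK] := eqVneq a K.
  by rewrite [RHS]mxE [X in _ + X]mxE mut_vec_subK !mxE eqxx; ring.
rewrite !mxE -/K (negPf ik) (negPf aK) sg_max_mul /= oppr0 add0r subr0.
congr (_ + _).
case: (ltrP (B K i) 0) => b0.
  rewrite mulN1r mulr0 sub0r [Num.max (- B K i) 0](max_idPl _) ?mulrN ?opprK.
    by rewrite mulrC.
  by rewrite oppr_ge0 ltW.
rewrite mul1r [Num.max (- B K i) 0](max_idPr _) ?oppr_le0 //.
by rewrite mulr0 subr0 mulrC.
Qed.

Lemma exch_mut_col_self : col k (exch_mut k B) = - col k B.
Proof. by apply/colP => a; rewrite !mxE eqxx orbT. Qed.

(** As E is an involution, (E b_i)^T E^T L E = b_i^T L E = d_i e_i^T E. *)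
Lemma mut_compatible eps i :
  (mut_mx eps *m col i B)^T *m deform_mut k B L =
  d 0 i *: row (lshift p i) (mut_mx eps).
Proof.
rewrite (deform_mutE eps) trmx_mul -[_ *m L *m _]mulmxA mulmxA.
rewrite -[_ *m _ *m (mut_mx eps)^T]mulmxA -trmx_mul mut_mx_invol trmx1 mulmx1.
rewrite mulmxA (compatible_row i BL).
by rewrite -scalemxAl trmx_std_mul.
Qed.

Lemma exch_mut_compatible :
  (exch_mut k B)^T *m deform_mut k B L = row_mx (diag_mx d) 0.
Proof.
apply: row_compatible => i; have [->|ik] := eqVneq i k.
  (* E fixes b_k because b_kk = 0, and row [K] of E is -e_K^T, so the two signs cancel. *)
  have -> : col k (exch_mut k B) = - (mut_mx false *m col k B).
    by rewrite exch_mut_col_self mut_mx_mul mxE exch_diag0 scale0r addr0.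
  rewrite linearN /= mulNmx mut_compatible mut_mx_row mut_vec_subK.
  by rewrite -scalerN scaleNr opprB scaler_nat mulr2n addrK.
rewrite (exch_mut_col ik) mut_compatible mut_mx_row scalerDr scalerA.
set e := B K i < 0.
(* The extra term of row i of E is the positive part of b_ik or of -b_ik. It vanishes since b_ik and
   b_ki have opposite signs and [e] follows the sign of b_ki. *)
suff -> : d 0 i * (mut_vec e - std K) (lshift p i) 0 = 0.
  by rewrite scale0r addr0.
rewrite !mxE eq_lshift (negPf ik) /= oppr0 add0r subr0.
have [d_gt0 _] := dB.
rewrite maxr_pMr ?ltW // mulr0 mulrCA skew_symmetrizer_entry /e.
case: (ltrP (B K i) 0) => b0; apply/max_idPr.
  rewrite expr1 mulN1r opprK; apply: mulr_ge0_le0; first exact: ltW.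
  exact: ltW.
by rewrite expr0 mul1r oppr_le0 mulr_ge0 // ltW.
Qed.

Lemma compatible_pair_mut :
  compatible_pair d (exch_mut k B) (deform_mut k B L).
Proof.
split; [exact: exch_mut_skew_symmetrizer| |exact: exch_mut_compatible].
rewrite (deform_mutE false) /skew_symmetric.
by rewrite !trmx_mul trmxK skewL mulNmx mulmxN mulmxA.
Qed.

End Mutation.

End Compatible.

(** * Quasi-commutation in a seed *)

(** Factors need not commute, so their order matters: the enumeration of indices is increasing, and
    filtering it to the two indices leaves i, then j. *)
Lemma prod_ord_pair (R : pzRingType) m (x : 'I_m -> R) (i j : 'I_m) :
  (i < j)%N -> (forall l, l != i -> l != j -> x l = 1) ->
  \prod_l x l = x i * x j.
Proof.
move=> ij x1; rewrite -(@big_rmcond _ _ _ _ _ (fun l => (l == i) || (l == j))).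
  rewrite -big_filter (_ : [seq _ <- _ | _] = [:: i; j]).
    by rewrite big_cons big_seq1.
  apply: (@irr_sorted_eq _ (relpre val ltn)) => //.
  - by move=> a b c; exact: ltn_trans.
  - by move=> a; exact: ltnn.
  - apply: sorted_filter; first by move=> a b c; exact: ltn_trans.
    by rewrite -sorted_map /index_enum -enumT val_enum_ord iota_ltn_sorted.
  - by rewrite /= ij.
  by move=> l; rewrite mem_filter mem_index_enum andbT !inE.
by move=> l; rewrite negb_or => /andP[]; exact: x1.
Qed.

Section QCommute.

Variable F : unitAlgType Kq.
Implicit Types (x y z : F) (a b : int).

(** The exponent counts powers of q^{1/2}; hence X_i and X_j satisfy it with a = 2 lambda_ij. *)
Definition qcommute a x y : Prop := x * y = qhalf ^ a *: (y * x).

Lemma scaler_unit_inj x (c c' : Kq) :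
  x \is a GRing.unit -> c *: x = c' *: x -> c = c'.
Proof.
move=> ux /eqP; rewrite -subr_eq0 -scalerBl scaler_eq0 subr_eq0.
case/orP => [/eqP //|/eqP x0].
by rewrite x0 unitr0 in ux.
Qed.

Lemma qcommute_sym a x y : qcommute a x y -> qcommute (- a) y x.
Proof. by rewrite /qcommute => ->; rewrite scalerA -qhalfD addNr scale1r. Qed.

Lemma qcommute1 z : qcommute 0 1 z.
Proof. by rewrite /qcommute mul1r mulr1 scale1r. Qed.

Lemma qcommuteM a b x y z :
  qcommute a x z -> qcommute b y z -> qcommute (a + b) (x * y) z.
Proof.
move=> xz yz; rewrite /qcommute -mulrA yz -scalerAr [in LHS]mulrA xz.
by rewrite -scalerAl scalerA -qhalfD addrC mulrA.
Qed.

Lemma qcommuteD a x y z :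
  qcommute a x z -> qcommute a y z -> qcommute a (x + y) z.
Proof. by rewrite /qcommute mulrDl mulrDr scalerDr => -> ->. Qed.

Lemma qcommuteZ a (c : Kq) x z : qcommute a x z -> qcommute a (c *: x) z.
Proof.
by rewrite /qcommute -scalerAl -scalerAr => ->; rewrite !scalerA mulrC.
Qed.

Lemma qcommuteV a x z :
  x \is a GRing.unit -> qcommute a x z -> qcommute (- a) x^-1 z.
Proof.
move=> ux xz; apply: (mulrI ux); rewrite mulVKr // -scalerAr !mulrA xz.
by rewrite -scalerAl mulrK // scalerA -qhalfD addNr scale1r.
Qed.

Lemma qcommuteXz a x z m :
  x \is a GRing.unit -> qcommute a x z -> qcommute (m * a) (x ^ m) z.
Proof.
move=> ux xz; elim/int_rect: m => [|m IH|m IH].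
- by rewrite mul0r expr0z; exact: qcommute1.
- by rewrite exprSz intS mulrDl mul1r; exact: qcommuteM.
rewrite intS opprD exprzDr // mulrDl mulN1r exprN1.
by apply: qcommuteM => //; exact: qcommuteV.
Qed.

Lemma qcommute_prod I (r : seq I) (a : I -> int) (x : I -> F) z :
  (forall i, qcommute (a i) (x i) z) ->
  qcommute (\sum_(i <- r) a i) (\prod_(i <- r) x i) z.
Proof.
move=> xz; apply: (big_ind2 (fun b y => qcommute b y z)) => //.
  exact: qcommute1.
by move=> b y b' y'; exact: qcommuteM.
Qed.

(** If y = -x, then x would quasi-commute with z with both exponents, and cancelling the unit z x
    would give a = b. *)
Lemma qcommute_add_neq0 a b x y z :
  x \is a GRing.unit -> z \is a GRing.unit ->
  qcommute a x z -> qcommute b y z -> a != b -> x + y != 0.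
Proof.
move=> ux uz xz yz; apply: contraNneq => /eqP; rewrite addr_eq0 => /eqP xy.
have yE : y = - x by rewrite xy opprK.
have xz' : qcommute b x z.
  by move: yz; rewrite yE /qcommute mulNr mulrN scalerN => /oppr_inj.
apply/eqP/qhalf_expz_inj/(@scaler_unit_inj (z * x)).
  by rewrite unitrMl.
by rewrite -xz.
Qed.

End QCommute.

(** * Normalized monomials and quantum seeds along mutations *)

Section Seeds.

Variables (F : unitAlgType Kq) (n p : nat).
Implicit Types (s : seed F n p) (e : 'cV[int]_(n + p)).

Definition cluster_unit s := forall i, cluster s i \is a GRing.unit.

Definition cluster_qcommute s :=
  forall i j, qcommute (2 * deform s i j) (cluster s i) (cluster s j).

Lemma nmon_unit s e : cluster_unit s -> nmon s e \is a GRing.unit.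
Proof.
move=> us; rewrite scaler_unit ?unitfE ?expfz_neq0 ?qhalf_neq0 //.
apply: (big_ind (fun x : F => x \is a GRing.unit)); first exact: unitr1.
  by move=> x y ux uy; rewrite unitrMl.
by move=> i _; exact/unitrXz/us.
Qed.

Lemma nmon_qcommute s e j :
  cluster_unit s -> cluster_qcommute s ->
  qcommute (2 * (e^T *m deform s) 0 j) (nmon s e) (cluster s j).
Proof.
move=> us qs; apply: qcommuteZ.
rewrite mxE mulr_sumr (eq_bigr (fun i => e i 0 * (2 * deform s i j))); last first.
  by move=> i _; rewrite mxE mulrCA.
by apply: qcommute_prod => i; exact: qcommuteXz.
Qed.

Lemma nmon_std s i : nmon s (std i) = cluster s i.
Proof.
rewrite /nmon big1 ?scale1r => [|a _]; last first.
  apply: big1 => b ab; rewrite !mxE !andbT.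
  have [ai|] := eqVneq a i; last by rewrite !mul0r.
  by rewrite -ai gt_eqF ?mulr0 ?mul0r.
rewrite (@big_only1 _ _ _ _ i) //; first by rewrite mxE !eqxx expr1z.
by move=> j ji _; rewrite mxE (negPf ji) expr0z.
Qed.

(** Recovers the normalization of X^{e_i + e_j} from quasi-commutation alone, so that it is
    available at every mutated seed. *)
Lemma nmon_pair s i j :
  cluster_unit s -> skew_symmetric (deform s) -> cluster_qcommute s ->
  cluster s i * cluster s j = qhalf ^ deform s i j *: nmon s (std i + std j).
Proof.
move=> us skewL qs.
have lt_case (i' j' : 'I_(n + p)) : (i' < j')%N ->
    cluster s i' * cluster s j' =
    qhalf ^ deform s i' j' *: nmon s (std i' + std j').
  move=> ij; have nij : i' != j' by rewrite -(inj_eq val_inj) ltn_eqF.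
  rewrite /nmon (prod_ord_pair ij) => [|l li lj]; last first.
    by rewrite !mxE (negPf li) (negPf lj) expr0z.
  rewrite !mxE !eqxx (negPf nij) eq_sym (negPf nij) !expr1z scalerA -qhalfD.
  rewrite (bigD1 i') //= (bigD1 j') //= big1 => [|b /andP[ib bj]]; last first.
    by rewrite !mxE (gt_eqF (ib : (i' < b)%O)) (negPf bj) mulr0 mul0r.
  rewrite big1 => [|a ai]; last first.
    apply: big1 => b ab; rewrite !mxE (negPf ai).
    have [aj|] := eqVneq a j'; last by rewrite !mul0r.
    have ib : (i' < b)%O by apply: ltn_trans ij _; rewrite -aj.
    by rewrite (gt_eqF ib) -aj (gt_eqF (ab : (a < b)%O)) mulr0 mul0r.
  rewrite !mxE !eqxx (negPf nij) [j' == i']eq_sym (negPf nij) /=.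
  by rewrite !mul1r !addr0 subrr scale1r.
have [ij|ji|/val_inj ->] := ltngtP i j; first exact: lt_case.
  (* Swapping the factors reduces to the ordered case: 2 lambda_ij + lambda_ji = lambda_ij. *)
  rewrite qs lt_case // scalerA -qhalfD addrC [std j + _]addrC.
  by rewrite (deform_skew_entry skewL j) mulrDl mul1r addKr.
have L0 : deform s j j = 0.
  have /eqP := deform_skew_entry skewL j j.
  by rewrite -subr_eq0 opprK -mulr2n mulrn_eq0 => /eqP.
rewrite L0 expr0z scale1r /nmon big1 ?scale1r => [|a _]; last first.
  apply: big1 => b ab; rewrite !mxE !andbT.
  have [aj|] := eqVneq a j; last by rewrite addr0 !mul0r.
  by rewrite -aj gt_eqF // addr0 mulr0 mul0r.
rewrite (@big_only1 _ _ _ _ j) //; first by rewrite !mxE !eqxx -expr2.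
by move=> l lj _; rewrite !mxE (negPf lj) addr0 expr0z.
Qed.

(** The invariant carried along the tree; the product rule for all monomials is assumed only at the
    initial seed. *)
Definition quantum_seed (d : 'rV[int]_n) s :=
  [/\ compatible_pair d (exch s) (deform s), cluster_unit s
    & cluster_qcommute s].

Lemma initial_seed_quantum d s :
  initial_quantum_seed d s -> quantum_seed d s.
Proof.
move=> [[dB skewL BL] [nmonM free divF _]]; split=> //.
  move=> i; apply: divF; rewrite -nmon_std.
  apply/eqP => X0.
  (* Freeness of the monomials, applied to the single term 1 X^{e_i}, shows X_i nonzero. *)
  have := free [:: std i] (fun=> 1) isT (fun=> laurent1).
  rewrite big_seq1 X0 scaler0 => /(_ erefl (std i)).
  rewrite mem_seq1 eqxx => /(_ isT) /eqP.
  by rewrite oner_eq0.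
move=> i j; rewrite /qcommute -!nmon_std !nmonM.
have stdL a b : ((std a)^T *m deform s *m std b) 0 0 = deform s a b.
  by rewrite trmx_std_mul -colE !mxE.
rewrite !stdL scalerA -qhalfD (deform_skew_entry skewL j) mulrDl mul1r addrK.
by rewrite [std j + _]addrC.
Qed.

Lemma mutate_cluster_K s k :
  cluster (mutate s k) (lshift p k) =
  nmon s (mut_vec (exch s) k false) + nmon s (mut_vec (exch s) k true).
Proof. by rewrite /= eqxx /mut_vec scale1r scaleN1r. Qed.

Lemma mutate_cluster_neq s k i :
  i != lshift p k -> cluster (mutate s k) i = cluster s i.
Proof. by move=> /negPf /= ->. Qed.

Lemma mutate_quantum d s k :
  (forall x : F, x != 0 -> x \is a GRing.unit) ->
  quantum_seed d s -> quantum_seed d (mutate s k).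
Proof.
move=> divF [[dB skewL BL] us qs].
have [dB' skewL' BL'] := compatible_pair_mut dB skewL BL k.
have qu eps j : qcommute (2 * ((mut_vec (exch s) k eps)^T *m deform s) 0 j)
    (nmon s (mut_vec (exch s) k eps)) (cluster s j).
  exact: nmon_qcommute.
have [d_gt0 _] := dB.
split=> //.
  move=> i; have [->|ik] := eqVneq i (lshift p k); last first.
    by rewrite mutate_cluster_neq.
  rewrite mutate_cluster_K; apply: divF.
  apply: (qcommute_add_neq0 _ (us (lshift p k)) (qu _ _) (qu _ _)).
    exact: nmon_unit.
  (* Against X_k, the quasi-commutation exponents of the two monomials differ by 2 d_k > 0. *)
  rewrite (mut_vec_sub_deform BL) [X in 2 * X]mxE [X in _ + X]mxE [_^T _ _]mxE.
  rewrite [std _ _ _]mxE !eqxx mulr1 (inj_eq (mulfI _)) //.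
  by rewrite -subr_eq0 addrAC subrr add0r gt_eqF.
have qK j : j != lshift p k ->
    qcommute (2 * deform (mutate s k) (lshift p k) j)
      (cluster (mutate s k) (lshift p k)) (cluster (mutate s k) j).
  move=> jk; rewrite mutate_cluster_K mutate_cluster_neq //.
  have -> : deform (mutate s k) (lshift p k) j =
      deform_mut_row k (exch s) (deform s) j.
    by rewrite mxE eq_sym (negPf jk) eqxx.
  (* Against X_j with j different from k, both monomials have the same exponent, so their sum
     quasi-commutes with X_j. *)
  apply: qcommuteD.
    by rewrite -(mut_vec_deform BL false jk); exact: qu.
  by rewrite -(mut_vec_deform BL true jk); exact: qu.
move=> i j; have [->|ij] := eqVneq i j.
  by rewrite mxE eqxx mulr0 /qcommute expr0z scale1r.
have [ik|ik] := eqVneq i (lshift p k).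
  by rewrite ik; apply: qK; rewrite -ik eq_sym.
have [->|jk] := eqVneq j (lshift p k).
  rewrite [deform _ _ _](deform_skew_entry skewL') mulrN.
  by apply: qcommute_sym; exact: qK.
by rewrite !mutate_cluster_neq // mxE (negPf ij) (negPf ik) (negPf jk).
Qed.

Lemma seed_at_quantum d s t :
  initial_quantum_seed d s -> quantum_seed d (seed_at s t).
Proof.
move=> init; have [_ [_ _ divF _]] := init.
elim/last_ind: t => [|t k IH]; first exact: initial_seed_quantum.
by rewrite /seed_at foldl_rcons; exact: mutate_quantum.
Qed.

Lemma seed_at_frozen s t (j : 'I_p) :
  cluster (seed_at s t) (rshift n j) = cluster s (rshift n j).
Proof.
elim/last_ind: t => [//|t k IH].
by rewrite /seed_at foldl_rcons mutate_cluster_neq ?eq_rlshift.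
Qed.

Lemma cluster_in_Aq s t i : in_Aq s (cluster (seed_at s t) i).
Proof.
by case: (split_ordP i) => j ->;
  [exact: Aq_cluster | rewrite seed_at_frozen; exact: Aq_frozen].
Qed.

End Seeds.


(** * Poisson brackets on a seed *)

Section Poisson.

Variables (F : unitAlgType Kq) (A : F -> Prop) (br : F -> F -> F).
Hypothesis AD : forall x y, A x -> A y -> A (x + y).
Hypothesis AM : forall x y, A x -> A y -> A (x * y).
Hypothesis Pbr : poisson_structure A br.

(** Polarization of {a + b, a + b} = 0. *)
Lemma bracket_antisym a b : A a -> A b -> br a b = - br b a.
Proof.
move=> Aa Ab; have Aab := AD Aa Ab.
have brDl x y z : A x -> A y -> A z -> br (x + y) z = br x z + br y z.
  move=> *; rewrite -[x]scale1r (br_linear_l Pbr) ?scale1r //.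
  exact: laurent1.
have brDr x y z : A x -> A y -> A z -> br z (x + y) = br z x + br z y.
  move=> *; rewrite -[x]scale1r (br_linear_r Pbr) ?scale1r //.
  exact: laurent1.
apply/eqP; rewrite -addr_eq0.
have := br_alternating Pbr Aab.
rewrite brDl // !brDr // !(br_alternating Pbr) // add0r addr0.
by move=> ->.
Qed.

Lemma bracket_leibniz_l a b c :
  A a -> A b -> A c -> br (a * b) c = br a c * b + a * br b c.
Proof.
move=> Aa Ab Ac; have Aab := AM Aa Ab.
rewrite bracket_antisym // (br_leibniz Pbr) // opprD -mulNr -mulrN.
by rewrite -!bracket_antisym.
Qed.

(* Expand {ab, cd} by the Leibniz rule in the two possible orders. *)
Lemma bracket_commutator a b c d : A a -> A b -> A c -> A d ->
  (a * c - c * a) * br b d = br a c * (b * d - d * b).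
Proof.
move=> Aa Ab Ac Ad; have Aab := AM Aa Ab; have Acd := AM Ac Ad.
(* The terms a{b, c}d and c{a, d}b occur in both expansions; cancelling them leaves the stated
   identity. *)
have cancel (V : zmodType) (x y z u v w : V) :
    x + y + (z + u) = v + z + (y + w) -> w - u = x - v.
  rewrite (addrC z) [LHS]addrACA (addrC y w) [RHS]addrACA (addrC z y).
  by move=> /addIr E; rewrite -[w](addKr v) -E addrA addrK addrC.
have E := bracket_leibniz_l Aa Ab Acd.
rewrite (br_leibniz Pbr) // !bracket_leibniz_l // !(br_leibniz Pbr) // in E.
move: E; rewrite !mulrDl !mulrDr !mulNr !mulrN !mulrA; exact: cancel.
Qed.
End Poisson.

Lemma poisson_matrix_cross (F : unitAlgType Kq) (n p : nat) (d : 'rV[int]_n)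
    (A : F -> Prop) (br : F -> F -> F) (s : seed F n p) (Om : 'M[Kq]_(n + p)) :
  (forall x y, A x -> A y -> A (x + y)) ->
  (forall x y, A x -> A y -> A (x * y)) ->
  poisson_structure A br -> quantum_seed d s ->
  (forall i, A (cluster s i)) -> poisson_matrix br s Om ->
  forall i j k l,
    qint (deform s i j) * Om k l = Om i j * qint (deform s k l).
Proof.
move=> AD AM Pbr [[_ skewL _] us qs] As omE i j k l.
have comm a b : cluster s a * cluster s b - cluster s b * cluster s a =
    (qhalf - qhalf^-1) * qint (deform s a b) *: nmon s (std a + std b).
  rewrite !nmon_pair // [std b + _]addrC -scalerBl (deform_skew_entry skewL b).
  by rewrite mulrC divfK ?qhalf_subV_neq0.
(* This is [X_i, X_j] {X_k, X_l} = {X_i, X_j} [X_k, X_l]; both sides are scalar multiples of the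
   unit X^{e_i + e_j} X^{e_k + e_l}, so the scalars agree. *)
have := bracket_commutator AD AM Pbr (As i) (As k) (As j) (As l).
have [_ ->] := omE k l; have [_ ->] := omE i j; rewrite !comm.
move: (nmon_unit (std i + std j) us) (nmon_unit (std k + std l) us).
move: (nmon s (std i + std j)) (nmon s (std k + std l)) => x y ux uy.
rewrite -!scalerAl -!scalerAr !scalerA => /scaler_unit_inj E.
by apply: (mulfI qhalf_subV_neq0); rewrite mulrA E 1?mulrCA ?unitrMl.
Qed.

(** The scalar c lives a priori in the fraction field: for type A_2 with lambda_12 = 2, D = 2I and
    omega_12 = 1 it is 1/[2]. Hence integrality is tied to a condition on W or on L. *)
Theorem proposition3p7 (F : unitAlgType Kq) (n p : nat) (d : 'rV[int]_n)
    (s0 : seed F n p) (br : F -> F -> F) (t : seq 'I_n)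
    (Om : 'M[Kq]_(n + p)) :
  initial_quantum_seed d s0 ->
  compatible_poisson s0 br ->
  poisson_matrix br (seed_at s0 t) Om ->
  let B := exch (seed_at s0 t) in
  let L := deform (seed_at s0 t) in
  let W := second_deformation L Om in
  exists c : Kq,
    [/\ skew_symmetrizer d B,
        (map_mx intr B)^T *m W = c *: row_mx (diag_mx (map_mx intr d)) 0,
        laurent_mx W -> laurent c
      & primitive_mx L -> laurent c].
Proof.
move=> init [Pbr _] omE B L W.
have qseed := seed_at_quantum t init.
have [[dB skewL BL] _ _] := qseed.
have cross := poisson_matrix_cross (@Aq_add _ _ _ s0) (@Aq_mul _ _ _ s0)
  Pbr qseed (cluster_in_Aq s0 t) omE.
rewrite -/B -/L in dB skewL BL cross.
have [L0|[i0 [j0 Lij0]]] : L = 0 \/ exists i j, L i j != 0.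
  have [/existsP[i /existsP[j Lij]]|noL] :=
    boolP [exists i, exists j, L i j != 0].
    by right; exists i, j.
  left; apply/matrixP => i j; rewrite [RHS]mxE; apply/eqP.
  apply: contraNT noL => Lij.
  by apply/existsP; exists i; apply/existsP; exists j.
  (* B^T 0 = (D O) with D > 0 forces n = 0. *)
  have n0 (i : 'I_n) : False.
    have := compatible_row i BL; rewrite L0 mulmx0 => /rowP /(_ (lshift p i)).
    rewrite !mxE !eqxx mulr1 => /esym/eqP.
    by have [/(_ i) d_gt0 _] := dB; rewrite gt_eqF.
  (* With n = 0 the matrix equation has no rows, so c = 0 will do. *)
  exists 0; split=> //; try by move=> _; exact: laurent0.
  by apply/matrixP => i; case: (n0 i).
(* One nonzero entry of L fixes the ratio of omega to [lambda]; [cross] propagates it to all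
   entries. *)
pose c := Om i0 j0 / qint (L i0 j0).
have OmE i j : Om i j = c * qint (L i j).
  by rewrite /c mulrAC -cross mulrC mulKf // qint_eq0.
have WE : W = c *: map_mx intr L.
  apply/matrixP => i j; rewrite !mxE OmE.
  (* Where lambda_ij = 0, W is omega_ij = c [0] = 0, in agreement with c lambda_ij. *)
  have [->|Lij] := eqVneq.
    by rewrite (eqP (_ : qint 0 == 0)) ?qint_eq0 ?mulr0.
  by rewrite mulrAC mulfK ?qint_eq0.
have cqint i j : laurent (c * qint (L i j)) by rewrite -OmE; have [] := omE i j.
exists c; split=> //.
- have -> : (map_mx intr B)^T = map_mx intr B^T :> 'M[Kq]_(n, n + p).
    by apply/matrixP => i j; rewrite !mxE.
  rewrite WE -scalemxAr -map_mxM BL map_row_mx map_diag_mx.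
  by rewrite map_mx0.
- move=> WL; apply: (laurent_of_mulz Lij0) => //.
  by have := WL i0 j0; rewrite WE !mxE.
by move=> L1; exact: (laurent_primitive L1).
Qed.
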